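(* Let $f$ be an isometry on $T=\mathbb T_q$ with respect to $d$ that exchanges $\omega_*$ with another boundary point $\omega_-\in\partial T$. Then $J_f$ does not belong to $A_\infty(\mu)$.
   Context: A tree is an infinite connected graph with no loops, identified with its set of vertices. $T=\mathbb T_q$ is the homogeneous tree of order $q+1$, namely the tree such that every vertex has exactly $q+1$ neighbours. $d$ is the geodesic distance. $\partial T$ is the boundary of $T$ (equivalence classes of semi-infinite geodesics, two being equivalent if they eventually coincide); isometries of $T$ onto itself with respect to $d$ act naturally on $\partial T$. Fix $\omega_*\in\partial T$; $[x,\omega_* )$ is the semi-infinite geodesic from $x$ to $\omega_*$, and $x\le y$ means $y\in[x,\omega_* )$. Fix $o\in T$, enumerate $[o,\omega_* )=\{x_j\}_{j\in\mathbb N}$ with $x_0=o$ and $d(x_j,x_k)=|j-k|$, and define the level $\ell(x)=\lim_{j\to\infty}(j-d(x,x_j))$. The canonical flow measure is $\mu(x)=q^{\ell(x)}$, and $\mu(E)=\sum_{y\in E}\mu(y)$ for $E\subset T$. For a bijection $f$ of $T$ onto itself, $J_f$ is the positive function on $T$ defined by $J_f(x)=\mu(f(x))/\mu(x)$. Fix a number $\beta\ge12$. For $x\in T$ and $h_1,h_2\in\mathbb N$, $h_1<h_2$, let $R_{h_1}^{h_2}(x)=\{y\in T:y\le x,\ h_1\le d(x,y)<h_2\}$; it is an admissible trapezoid if $2\le h_2/h_1\le\beta$. $\mathcal R$ is the family of all admissible trapezoids and all singletons. For $p\in(1,\infty)$, a positive function $w$ on $T$ is in $A_p(\mu)$ if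 $$\sup_{R\in\mathcal R}\Big(\frac1{\mu(R)}\sum_{y\in R}w(y)\mu(y)\Big)\Big(\frac1{\mu(R)}\sum_{y\in R}w(y)^{-1/(p-1)}\mu(y)\Big)^{p-1}<\infty,$$ and $A_\infty(\mu)=\bigcup_{p>1}A_p(\mu)$.
   Formalization: The homogeneous tree is taken with q at least 2: for q = 1 the tree is the integers, the flow measure is constant, and x -> -x exchanges the two boundary points with J_f = 1, which lies in A_infinity, so the claim fails there. *)

(* Defs.v *)
From HB Require Import structures.
From mathcomp Require Import all_boot all_order all_algebra.
From mathcomp Require Import all_classical all_reals all_analysis.

Set Implicit Arguments.
Unset Strict Implicit.
Unset Printing Implicit Defensive.

Import Order.TTheory GRing.Theory Num.Theory.
Import numFieldNormedType.Exports.

Local Open Scope classical_set_scope.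
Local Open Scope ring_scope.

(* A graph is given by its adjacency relation [e] on the vertex type [T]. *)

Definition connected_graph (T : choiceType) (e : rel T) : Prop :=
  forall x y : T, exists2 s : seq T, path e x s & last x s = y.

(* [cycle e [:: x; y]] holds along every edge of a symmetric relation (go and
   come back), so genuine circuits are those with at least three vertices. *)
Definition acyclic_graph (T : choiceType) (e : rel T) : Prop :=
  forall c : seq T, (2 < size c)%N -> uniq c -> ~~ cycle e c.

Definition is_tree (T : choiceType) (e : rel T) : Prop :=
  [/\ symmetric e, irreflexive e, connected_graph e, acyclic_graph e
    & infinite_set [set: T]].

Definition homogeneous_tree (q : nat) (T : choiceType) (e : rel T) : Prop :=
  is_tree e /\ forall x : T, ([set y | e x y] #= `I_q.+1)%card.

(* The default value 0 is only reached when no path joins [x] to [y]. *)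
Definition dist (T : choiceType) (e : rel T) (x y : T) : nat :=
  xget 0%N [set n : nat |
    (exists s : seq T, [/\ path e x s, last x s = y & size s = n]) /\
    (forall s : seq T, path e x s -> last x s = y -> (n <= size s)%N)].

Definition tree_isometry (T : choiceType) (e : rel T) (f : T -> T) : Prop :=
  bijective f /\ forall x y : T, dist e (f x) (f y) = dist e x y.

(* Below, [`|j - k|%N] is the absolute difference of natural numbers. *)
Definition geodesic_ray (T : choiceType) (e : rel T) (g : nat -> T) : Prop :=
  forall j k : nat, dist e (g j) (g k) = `|j%:Z - k%:Z|%N.

Definition ray_equiv (T : choiceType) (g h : nat -> T) : Prop :=
  exists m n : nat, forall k : nat, g (m + k)%N = h (n + k)%N.

(* A boundary point is an equivalence class, that is, a set of rays. *)
Definition boundary (T : choiceType) (e : rel T) : set (set (nat -> T)) :=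
  [set w | exists2 g : nat -> T, geodesic_ray e g &
     w = [set h | geodesic_ray e h /\ ray_equiv g h]].

Definition boundary_act (T : choiceType) (f : T -> T) (w : set (nat -> T)) :
  set (nat -> T) := [set f \o g | g in w].

(* In a tree, a boundary point [w] contains exactly one ray starting at [x]:
   [ray_to w x] is that ray, and its range is the half-line [x, w). *)
Definition ray_to (T : choiceType) (w : set (nat -> T)) (x : T) : nat -> T :=
  xget (fun=> x) [set g | w g /\ g 0%N = x].

Definition half_line (T : choiceType) (w : set (nat -> T)) (x : T) : set T :=
  range (ray_to w x).

Definition tree_le (T : choiceType) (w : set (nat -> T)) (x y : T) : Prop :=
  half_line w x y.

Definition level (R : realType) (T : choiceType) (e : rel T)
    (w : set (nat -> T)) (o x : T) : R :=
  lim ((j%:R - (dist e x (ray_to w o j))%:R : R) @[j --> \oo]).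

Definition flow (R : realType) (q : nat) (T : choiceType) (e : rel T)
    (w : set (nat -> T)) (o x : T) : R :=
  q%:R `^ level R e w o x.

Definition trapezoid (T : choiceType) (e : rel T) (w : set (nat -> T))
    (h1 h2 : nat) (x : T) : set T :=
  [set y | tree_le w y x /\ (h1 <= dist e x y < h2)%N].

(* For [h1 = 0] the quotient [h2%:R / h1%:R] is 0 by convention, so the first
   inequality fails and the trapezoid is not admissible, as it should be. *)
Definition admissible_family (R : realType) (beta : R) (T : choiceType)
    (e : rel T) (w : set (nat -> T)) : set (set T) :=
  [set E | (exists x : T, E = [set x]) \/
     exists (x : T) (h1 h2 : nat),
       [/\ (h1 < h2)%N, 2 <= h2%:R / h1%:R :> R, h2%:R / h1%:R <= beta
         & E = trapezoid e w h1 h2 x]].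

(* Sums over a set are the library's finitely supported sums; by
   [finite_admissible_family] below they are only taken over finite sets. *)
Definition weight (R : realType) (T : choiceType) (mu : T -> R) (E : set T) : R :=
  \sum_(y \in E) mu y.

Definition average (R : realType) (T : choiceType) (mu : T -> R) (E : set T)
    (w : T -> R) : R :=
  (weight mu E)^-1 * \sum_(y \in E) (w y * mu y).

Definition A_p (R : realType) (T : choiceType) (mu : T -> R)
    (F : set (set T)) (p : R) : set (T -> R) :=
  [set w | (forall x, 0 < w x) /\
     (ereal_sup [set (average mu E w *
        average mu E (fun y => w y `^ (- 1 / (p - 1))) `^ (p - 1))%:E
        | E in F] < +oo)%E].

Definition A_infty (R : realType) (T : choiceType) (mu : T -> R)
    (F : set (set T)) : set (T -> R) :=
  \bigcup_(p in [set p : R | 1 < p]) A_p mu F p.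

Definition J (R : realType) (T : choiceType) (mu : T -> R) (f : T -> T)
    (x : T) : R := mu (f x) / mu x.

Lemma flow_gt0 (R : realType) (q : nat) (T : choiceType) (e : rel T)
    (w : set (nat -> T)) (o x : T) : (0 < q)%N -> 0 < flow R q e w o x.
Proof. by move=> q0; rewrite powR_gt0 // ltr0n. Qed.

Lemma J_flow_gt0 (R : realType) (q : nat) (T : choiceType) (e : rel T)
    (w : set (nat -> T)) (o : T) (f : T -> T) (x : T) :
  (0 < q)%N -> 0 < J (flow R q e w o) f x.
Proof. by move=> q0; rewrite divr_gt0 // flow_gt0. Qed.

Lemma distP (T : choiceType) (e : rel T) (x y : T) : connected_graph e ->
  (exists s, [/\ path e x s, last x s = y & size s = dist e x y]) /\
  (forall s, path e x s -> last x s = y -> (dist e x y <= size s)%N).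
Proof.
move=> /(_ x y)[s0 ps0 ls0]; rewrite /dist; case: xgetP => [n _ //|nP].
pose P n := `[< exists s, [/\ path e x s, last x s = y & size s = n] >].
have exP : exists n, P n by exists (size s0); apply/asboolP; exists s0.
have [n /asboolP Pn minn] := ex_minnP exP.
exfalso; apply: (nP n); split=> // s ps ls; apply: minn.
by apply/asboolP; exists s.
Qed.

Lemma finite_ball (q : nat) (T : choiceType) (e : rel T) (x : T) (n : nat) :
  homogeneous_tree q e -> finite_set [set y | (dist e x y < n)%N].
Proof.
move=> [[_ _ ce _ _] reg].
pose B m x := [set y | exists s, [/\ path e x s, last x s = y & size s = m]].
have finB m : forall x, finite_set (B m x).
  elim: m => [|m IH] z.
    apply: (sub_finite_set _ (finite_set1 z)) => y [s [_ <- /size0nil ->]] //.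
  apply: (@sub_finite_set _ _ (\bigcup_(t in [set t | e z t]) B m t)).
    by move=> y [[|t s] [//= /andP[zt ps] ls [ss]]]; exists t => //; exists s.
  by apply: bigcup_finite => //; exists q.+1; exact: reg.
apply: (@sub_finite_set _ _ (\bigcup_(m in `I_n) B m x)); last first.
  by apply: bigcup_finite => //; exact: finite_II.
by move=> y yn; exists (dist e x y) => //; exact: (distP x y ce).1.
Qed.

Lemma finite_admissible_family (R : realType) (beta : R) (q : nat)
    (T : choiceType) (e : rel T) (w : set (nat -> T)) (E : set T) :
  homogeneous_tree q e -> admissible_family beta e w E -> finite_set E.
Proof.
move=> he [[x ->]|[x [h1 [h2 [_ _ _ ->]]]]]; first exact: finite_set1.
by apply: sub_finite_set (finite_ball x h2 he) => y [_ /andP[]].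
Qed.

(* Main.v *)
Require Import Defs.
From mathcomp Require Import all_boot all_order all_algebra.
From mathcomp Require Import all_classical all_reals all_analysis.
From mathcomp Require Import finmap zify ring.

(** Call [w] the boundary point that defines the levels and [v] the other one,
    and write [up] and [up'] for the maps sending a vertex to the next one on its
    ray to [w] and to [v]. The mass of [up x] is [q] times that of [x]. As [f]
    maps the ray from [x] to [v] onto the ray from [f x] to [w], one has
    [f (up' x) = up (f x)] ([parent_act]), and [J f] can be followed along edges:

    - if [up' y = up y], then [f (up y) = up (f y)]: passing from [y] to [up y]
      raises the level of both [y] and [f y], so [J f] keeps its value
      ([J_off_axis]);
    - if [up (up' z) = z], which happens on the axis joining [v] to [w], passing
      from [z] to [up' z] lowers the level of [z] and raises that of [f z], so
      [J f] is multiplied by [q ^ 2] ([J_axis]).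

    Some vertex [x] has [up' x <> up x], because [v <> w]; it lies on the axis.
    Consider the trapezoid rooted at [x] with heights [h] and [2 h]; its mass is
    [h * mu x], because each generation of descendants of [x] has mass [mu x]
    ([flow_trapezoid]).

    - It contains the axis vertex [z] at depth [m = 2 h - 1], where
      [J f z * mu z = q ^ m * J f x * mu x]. This single vertex makes the
      average of [J f] at least [q ^ m * J f x / h].
    - As [q > 1], [x] has a child [a] off the axis. On the descendants of [a],
      which make up a proportion [1 / q] of the trapezoid, [J f] is constantly
      [J f x]. This makes the average of [J f `^ (- 1 / (p - 1))] at least
      [J f x `^ (- 1 / (p - 1)) / q], for every exponent [p > 1].

    The product in the [A_p] condition is thus at least
    [q ^ (2 h - 1) / h * q `^ (1 - p) >= h * q `^ (1 - p)], which is unbounded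
    in [h] ([A_p_lower_bound]). *)

Import Order.TTheory GRing.Theory Num.Theory.
Import numFieldNormedType.Exports.

Local Open Scope classical_set_scope.
Local Open Scope ring_scope.

(** * Simple paths and geodesic rays in a tree *)

Section Tree.

Set Implicit Arguments.
Unset Strict Implicit.

Variables (T : choiceType) (e : rel T).
Hypothesis tree_e : is_tree e.

Let e_sym : symmetric e. Proof. by case: tree_e. Qed.
Let e_irr : irreflexive e. Proof. by case: tree_e. Qed.
Let e_con : connected_graph e. Proof. by case: tree_e. Qed.
Let e_acy : acyclic_graph e. Proof. by case: tree_e. Qed.

(** Otherwise the edge would close the path into a circuit. *)
Lemma uniq_path_of_edge x s :
  path e x s -> uniq (x :: s) -> e x (last x s) -> s = [:: last x s].
Proof.
case: s => [|a [|b s]] //; first by rewrite /= e_irr.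
move=> ps us el; have := e_acy (c := [:: x, a, b & s]) isT us.
by rewrite /cycle rcons_path ps e_sym el.
Qed.

(** If the two paths left [x] through different neighbours [a] and [b], going
    from [a] along the first path to the common end and back along the second
    to [b] would avoid [x]; a simple path extracted from this walk, closed up
    through [x], would be a circuit. *)
Lemma uniq_path_inj x s t :
  path e x s -> path e x t -> uniq (x :: s) -> uniq (x :: t) ->
  last x s = last x t -> s = t.
Proof.
elim: s x t => [|a s IH] x [|b t] //=.
- by move=> _ _ _ /andP[/negP xt _] xE; case: xt; rewrite {1}xE mem_last.
- by move=> _ _ /andP[/negP xs _] _ xE; case: xs; rewrite -{1}xE mem_last.
move=> /andP[xa pa] /andP[xb pb] /andP[xs us] /andP[xt ut] lst.
have [ab|/eqP ab] := eqVneq a b.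
  by rewrite -ab in pb ut lst *; congr cons; exact: (IH a).
pose c := s ++ rev (belast b t).
have pc : path e a c.
  by rewrite cat_path pa lst rev_path (eq_path (e' := e)).
have lc : last a c = b.
  rewrite last_cat; case: (t) lst => [|t0 t'] lst //=.
  by rewrite rev_cons last_rcons.
have xc : x \notin a :: c.
  rewrite -cat_cons mem_cat negb_or xs mem_rev.
  by apply: contra xt => /mem_belast.
case/shortenP: pc lc => c' pc' uc' sc' lc'.
have xc' : x \notin a :: c'.
  by apply: contra xc; rewrite !inE => /orP[->//|/sc' ->]; rewrite orbT.
case: c' pc' uc' sc' lc' xc' => [|d c'] pc' uc' _ lc' xc'; first by case: ab.
have uc : uniq [:: x, a, d & c'] by rewrite cons_uniq xc'.
have := e_acy (c := [:: x, a, d & c']) isT uc.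
rewrite /cycle rcons_path /= -/(path e a (d :: c')) xa pc'.
by rewrite -[last d c']/(last a (d :: c')) lc' e_sym xb.
Qed.

Lemma dist_uniq_path x s :
  path e x s -> uniq (x :: s) -> dist e x (last x s) = size s.
Proof.
move=> ps us; have [[s0 [ps0 ls0 ss0]] mins] := distP x (last x s) e_con.
case/shortenP: ps0 ls0 => t pt ut tsub lt.
have ts : t = s by exact: (uniq_path_inj pt).
apply/eqP; rewrite eqn_leq mins //= -ss0 -ts.
by apply: uniq_leq_size => //; case/andP: ut.
Qed.

Lemma distxx x : dist e x x = 0%N.
Proof. exact: (@dist_uniq_path x [::]). Qed.

Lemma dist_le_rev x y : (dist e y x <= dist e x y)%N.
Proof.
have [[s [ps ls <-]] _] := distP x y e_con.
have [_ mins] := distP y x e_con.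
have <- : size (rev (belast x s)) = size s by rewrite size_rev size_belast.
apply: mins.
  by rewrite -ls rev_path (eq_path (e' := e)).
by rewrite -ls; case: (s) => //= a t; rewrite rev_cons last_rcons.
Qed.

Lemma dist_sym x y : dist e x y = dist e y x.
Proof. by apply/eqP; rewrite eqn_leq !dist_le_rev. Qed.

Lemma edge_of_dist x y : dist e x y = 1%N -> e x y.
Proof.
have [[s [ps ls <-]] _] := distP x y e_con.
by case: s ps ls => [|a []] //= /andP[xa _] <-.
Qed.

Lemma mkseqSl (g : nat -> T) n : mkseq g n.+1 = g 0%N :: mkseq (g \o S) n.
Proof. by rewrite /mkseq /= -[iota 1 n]/(iota (1 + 0) n) iotaDl -map_comp. Qed.

Lemma path_mkseq (g : nat -> T) n :
  (forall i, e (g i) (g i.+1)) -> path e (g 0%N) (mkseq (g \o S) n).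
Proof.
elim: n g => [//|n IH] g eg; rewrite mkseqSl /= eg.
by apply: (IH (g \o S)) => i; exact: eg.
Qed.

Lemma last_mkseq (g : nat -> T) n : last (g 0%N) (mkseq (g \o S) n) = g n.
Proof. by case: n => // n; rewrite mkseqS last_rcons. Qed.

Lemma mkseq_shift_uniq (g : nat -> T) n :
  injective g -> uniq (g 0%N :: mkseq (g \o S) n).
Proof.
by move=> gI; rewrite -mkseqSl; exact: mkseq_uniq.
Qed.

(** A purely local description, easy to check for a ray with its first vertex
    deleted or with a new one put in front. *)
Lemma geodesic_rayP (g : nat -> T) :
  geodesic_ray e g <-> (forall i, e (g i) (g i.+1)) /\ injective g.
Proof.
split=> [gg|[eg gI] j k].
  split=> [i|i j gij]; first by apply: edge_of_dist; rewrite gg; lia.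
  by have := gg i j; rewrite gij distxx; lia.
have E a b : dist e (g a) (g (a + b)%N) = b.
  pose g' i := g (a + i)%N.
  have eg' i : e (g' i) (g' i.+1) by rewrite /g' addnS.
  have g'I : injective g' by move=> u v /gI /addnI.
  have := dist_uniq_path (path_mkseq b eg') (mkseq_shift_uniq b g'I).
  by rewrite last_mkseq size_mkseq /g' addn0.
case: (leqP j k) => [jk|/ltnW kj].
  by have := E j (k - j)%N; rewrite subnKC // => ->; lia.
by have := E k (j - k)%N; rewrite subnKC // dist_sym => ->; lia.
Qed.

End Tree.

(** * The parent map towards a boundary point *)

Section BoundaryPoint.

Set Implicit Arguments.
Unset Strict Implicit.

Variables (T : choiceType) (e : rel T).
Hypothesis tree_e : is_tree e.

Variable w : set (nat -> T).

Definition parent (x : T) : T := ray_to w x 1%N.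

Definition children (x : T) : set T := [set y | parent y = x].

Definition descendants (j : nat) (x : T) : set T :=
  [set y | iter j parent y = x].

Hypothesis bw : boundary e w.

Let e_sym : symmetric e. Proof. by case: tree_e. Qed.
Let e_con : connected_graph e. Proof. by case: tree_e. Qed.

Lemma boundary_ray g : w g -> geodesic_ray e g.
Proof. by case: bw => g0 _ ->; case. Qed.

Lemma boundary_equiv g h : w g -> w h -> ray_equiv g h.
Proof.
case: bw => g0 _ -> [_ [a [b gab]]] [_ [c [d hcd]]].
exists (b + c)%N, (d + a)%N => k.
by rewrite -addnA -gab addnCA hcd addnA.
Qed.

Lemma boundary_closed g h :
  w g -> geodesic_ray e h -> ray_equiv g h -> w h.
Proof.
case: bw => g0 _ -> [_ [a [b gab]]] gh [c [d hcd]]; split=> //.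
exists (a + c)%N, (d + b)%N => k.
by rewrite -addnA gab addnCA hcd addnA.
Qed.

(** Two equivalent rays from the same vertex run through a common vertex; the
    simple paths leading to it coincide, which forces the two shifts of the
    equivalence to be equal. *)
Lemma ray_inj g h : w g -> w h -> g 0%N = h 0%N -> g = h.
Proof.
move=> wg wh gh0; have [m [n E]] := boundary_equiv wg wh.
have [eg gI] := (geodesic_rayP tree_e g).1 (boundary_ray wg).
have [eh hI] := (geodesic_rayP tree_e h).1 (boundary_ray wh).
have P k : mkseq (g \o S) (m + k) = mkseq (h \o S) (n + k).
  apply: (uniq_path_inj tree_e (x := g 0%N)); rewrite ?last_mkseq.
  - exact: path_mkseq.
  - by rewrite gh0; exact: path_mkseq.
  - exact: mkseq_shift_uniq.
  - by rewrite gh0; exact: mkseq_shift_uniq.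
  - by rewrite gh0 last_mkseq E.
apply/funext => -[//|i].
have := congr1 (nth (g 0%N) ^~ i) (P i.+1).
by rewrite !nth_mkseq //; lia.
Qed.

Lemma ray_shift g : w g -> w (g \o S).
Proof.
move=> wg; have [eg gI] := (geodesic_rayP tree_e g).1 (boundary_ray wg).
apply: (boundary_closed wg); last by exists 1%N, 0%N.
by apply/(geodesic_rayP tree_e); split=> [i|i j /gI[]] //=; exact: eg.
Qed.

(** The new first vertex [y] cannot lie further along the ray, since the edge
    from [g 0] to [y] is the only simple path between its ends. *)
Lemma ray_cons g y : w g -> e (g 0%N) y -> g 1%N <> y ->
  w (fun i => if i is j.+1 then g j else y).
Proof.
move=> wg gy g1y; have [eg gI] := (geodesic_rayP tree_e g).1 (boundary_ray wg).
have gNy k : g k <> y.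
  move=> gky; apply: g1y; have := uniq_path_of_edge tree_e
    (path_mkseq k eg) (mkseq_shift_uniq k gI).
  rewrite last_mkseq gky => /(_ gy) E; rewrite -gky.
  by have := congr1 size E; rewrite size_mkseq /= => ->.
apply: (boundary_closed wg); last by exists 0%N, 1%N.
apply/(geodesic_rayP tree_e); split=> [[|i]|[|i] [|j]] //=.
- by rewrite e_sym.
- by move=> /esym /gNy.
- by move=> /gNy.
- by move=> /gI ->.
Qed.

(** Induction along a path from a given ray to [x]: when the next vertex of the
    path is the second vertex of the ray, drop the first; otherwise the new
    vertex can be put in front. *)
Lemma ray_exists x : exists2 g, w g & g 0%N = x.
Proof.
have [g0 rg0 wE] := bw; have wg0 : w g0.
  by rewrite wE; split=> //; exists 0%N, 0%N.
have [s ps <-] := e_con (g0 0%N) x.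
elim/last_ind: s ps => [|s y IH]; first by exists g0.
rewrite rcons_path last_rcons => /andP[/IH[g wg <-] gy] {IH}.
have [g1y|/eqP g1y] := eqVneq (g 1%N) y.
  by exists (g \o S); [exact: ray_shift|].
by eexists; [exact: (ray_cons wg gy g1y)|].
Qed.

Lemma ray_toP x : w (ray_to w x) /\ ray_to w x 0%N = x.
Proof.
rewrite /ray_to; case: xgetP => [g _ //|/=].
by have [g wg gx] := ray_exists x => /(_ g)[].
Qed.

Lemma ray_to_unique g : w g -> ray_to w (g 0%N) = g.
Proof. by move=> wg; have [? ?] := ray_toP (g 0%N); exact: ray_inj. Qed.

Lemma ray_toE x k : ray_to w x k = iter k parent x.
Proof.
elim: k x => [|k IH] x; first exact: (ray_toP x).2.
rewrite iterSr -IH; have [wr r0] := ray_toP x.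
by rewrite -[parent x]/((ray_to w x \o S) 0%N) (ray_to_unique (ray_shift wr)).
Qed.

Lemma dist_parent x j k :
  dist e (iter j parent x) (iter k parent x) = `|j%:Z - k%:Z|%N.
Proof. by rewrite -!ray_toE; exact: (boundary_ray (ray_toP x).1). Qed.

Lemma parent_edge x : e x (parent x).
Proof. by apply: (edge_of_dist tree_e); exact: (dist_parent x 0 1). Qed.

Lemma iter_parent_inj x : injective (fun k => iter k parent x).
Proof.
move=> j k /= jk; have := dist_parent x j k.
by rewrite jk (distxx tree_e); lia.
Qed.

Lemma parent_parent x : parent (parent x) <> x.
Proof. by move=> /(@iter_parent_inj x 2 0). Qed.

(** Every edge is oriented towards the boundary point: if the ray from [x] does
    not use the edge, putting [y] in front of it gives the ray from [y]. *)
Lemma edge_parent x y : e x y -> parent x = y \/ parent y = x.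
Proof.
move=> xy; have [|/eqP pxy] := eqVneq (parent x) y; first by left.
right; have [wr r0] := ray_toP x.
rewrite -{1}r0 in xy; have wg := ray_cons wr xy pxy.
by rewrite /parent (ray_to_unique wg).
Qed.

Lemma iter_parent_confluent x y :
  exists m n, iter m parent x = iter n parent y.
Proof.
have [m [n E]] := boundary_equiv (ray_toP x).1 (ray_toP y).1.
by exists m, n; rewrite -!ray_toE -[m]addn0 -[n]addn0 E.
Qed.

Lemma tree_leE x y : tree_le w x y <-> exists k, iter k parent x = y.
Proof.
by split=> [[k _ <-]|[k <-]]; exists k => //; rewrite ray_toE.
Qed.

(** The sequence whose limit is the level is constant from [n] on: the geodesic
    from [x] to a far vertex of the ray from [o] passes through the common
    ancestor. *)
Lemma level_confluent (R : realType) o x m n :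
  iter m parent x = iter n parent o ->
  level R e w o x = n%:R - m%:R.
Proof.
move=> xo; rewrite /level; apply: (@cvg_lim R); first exact: norm_hausdorff.
apply: cvg_near_cst; exists n => // j /= nj.
have <- : iter (m + (j - n)) parent x = ray_to w o j.
  by rewrite addnC iterD xo -iterD subnK // ray_toE.
rewrite (dist_parent x 0) sub0r abszN absz_nat natrD natrB //.
by ring.
Qed.

Lemma level_parent (R : realType) o x :
  level R e w o (parent x) = level R e w o x + 1.
Proof.
have [m [n E]] := iter_parent_confluent x o.
have E1 : iter m.+1 parent x = iter n.+1 parent o by rewrite !iterS E.
rewrite (level_confluent R E1) (@level_confluent R o (parent x) m n.+1).
  by rewrite -[m.+1]addn1 natrD opprD addrA subrK.
by rewrite -iterSr.
Qed.

Lemma flow_parent (R : realType) q o x : (0 < q)%N ->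
  flow R q e w o (parent x) = q%:R * flow R q e w o x.
Proof.
move=> q0; rewrite /flow level_parent powRD ?powRr1 ?ler0n 1?mulrC //.
by rewrite pnatr_eq0 -lt0n q0 implybT.
Qed.

End BoundaryPoint.

(** * Finitely supported sums *)

Section FiniteSums.

Set Implicit Arguments.
Unset Strict Implicit.

Lemma fsum_fibers (V : nmodType) (T I : choiceType) (g : T -> I) (A : set I)
    (D : set T) (F : T -> V) :
  finite_set A -> finite_set D -> (forall y, D y -> A (g y)) ->
  \sum_(y \in D) F y = \sum_(i \in A) \sum_(y \in D `&` g @^-1` [set i]) F y.
Proof.
move=> fA fD gA.
under [RHS]eq_fsbigr do rewrite fsbig_mkcondr.
rewrite exchange_fsbig //; apply: eq_fsbigr => y /set_mem Dy.
rewrite (fsbigD1 (g y)) ?fsbig1 ?addr0 //=.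
- by rewrite mem_set // addr0.
- by move=> i [_ /= ig]; rewrite memNset //= => /esym.
- exact: gA.
Qed.

Lemma fsum_const (V : nmodType) (I : choiceType) (r : seq I) (c : V) :
  uniq r -> \sum_(i \in [set` r]) c = c *+ size r.
Proof.
by move=> ur; rewrite -fsbig_seq // big_const_seq count_predT iter_addr addr0.
Qed.

Lemma ler_fsum_subset (R : realType) (I : choiceType) (A B : set I)
    (F : I -> R) :
  finite_set B -> A `<=` B -> (forall i, 0 <= F i) ->
  \sum_(i \in A) F i <= \sum_(i \in B) F i.
Proof.
move=> fB AB F0; rewrite [leRHS](fsbigID A) // [B `&` A]setIC.
by rewrite (setIidl AB) lerDl; exact: fsumr_ge0.
Qed.

End FiniteSums.

(** * The flow measure of trapezoids *)

Section FlowMeasure.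

Set Implicit Arguments.
Unset Strict Implicit.

Variables (R : realType) (q : nat) (T : choiceType) (e : rel T).
Hypotheses (q_gt1 : (1 < q)%N) (hom : homogeneous_tree q e).
Variable w : set (nat -> T).
Hypothesis bw : boundary e w.
Variable o : T.

Let tree_e : is_tree e. Proof. by case: hom. Qed.
Let q_gt0 : (0 < q)%N. Proof. exact: ltnW. Qed.

Local Notation mu := (flow R q e w o).
Local Notation parent := (parent w).

Lemma childrenE x : children w x = [set y | e x y] `\ parent x.
Proof.
have [e_sym _ _ _ _] := tree_e.
apply/seteqP; split=> y /=.
  move=> yx; split; first by rewrite -yx e_sym (parent_edge tree_e bw).
  by move=> yE; apply: (parent_parent tree_e bw (x := x)); rewrite -yE.
by move=> [/(edge_parent tree_e bw)[/esym|]].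
Qed.

Lemma finite_children x : finite_set (children w x).
Proof. by rewrite childrenE; apply: finite_setD; exists q.+1; exact: hom.2. Qed.

Lemma card_children x : #|` fset_set (children w x)| = q.
Proof.
have [_ /(_ x) N] := hom; have fN : finite_set [set y | e x y] by exists q.+1.
rewrite childrenE fset_setD1 //.
have := cardfsD1 (parent x) (fset_set [set y | e x y]).
rewrite in_fset_set // mem_set /=; last exact: (parent_edge tree_e bw).
by rewrite (card_fset_set N) => -[].
Qed.

(** This conservation law is why the measure is called a flow: each of the [q]
    children carries [1 / q] of the mass. *)
Lemma flow_children x : \sum_(y \in children w x) mu y = mu x.
Proof.
have q0 : q%:R != 0 :> R by rewrite pnatr_eq0 -lt0n.
under eq_fsbigr => y /set_mem yx.
  rewrite (_ : mu y = mu x / q%:R); last first.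
    by rewrite -yx (flow_parent tree_e bw) // mulrC mulKf.
  over.
rewrite -{1}(fset_setK (finite_children x)) fsum_const // card_children.
by rewrite -[_ *+ _]mulr_natr divfK.
Qed.

Lemma dist_descendant j x y : descendants w j x y -> dist e x y = j.
Proof.
by move=> <-; rewrite (dist_parent tree_e bw y j 0) subr0 absz_nat.
Qed.

Lemma finite_descendants j x : finite_set (descendants w j x).
Proof.
apply: sub_finite_set (finite_ball x j.+1 hom) => y /dist_descendant /= ->.
exact: leqnn.
Qed.

Lemma flow_descendants j x : \sum_(y \in descendants w j x) mu y = mu x.
Proof.
elim: j x => [|j IH] x; first exact: fsbig_set1.
rewrite (fsum_fibers (g := iter j parent) mu (finite_children x)
  (finite_descendants j.+1 x)) //.
rewrite -[RHS]flow_children; apply: eq_fsbigr => c /set_mem cx.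
rewrite -[RHS]IH; apply: eq_fsbigl; apply/seteqP; split=> y /=; first by case.
by move=> yc; split=> //; rewrite /descendants /= yc.
Qed.

Lemma trapezoidP h1 h2 x y :
  trapezoid e w h1 h2 x y <-> exists2 j, (h1 <= j < h2)%N & descendants w j x y.
Proof.
split=> [[/(tree_leE tree_e bw)[j jx]]|[j jh jx]].
  by rewrite (dist_descendant jx); exists j.
split; last by rewrite (dist_descendant jx).
by apply/(tree_leE tree_e bw); exists j.
Qed.

Lemma finite_trapezoid h1 h2 x : finite_set (trapezoid e w h1 h2 x).
Proof. by apply: sub_finite_set (finite_ball x h2 hom) => y [_ /andP[]]. Qed.

Lemma flow_trapezoid h1 h2 x :
  weight mu (trapezoid e w h1 h2 x) = (h2 - h1)%:R * mu x.
Proof.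
pose r := iota h1 (h2 - h1).
have rE j : (j \in r) = (h1 <= j < h2)%N by rewrite mem_iota; lia.
have tr y : trapezoid e w h1 h2 x y -> [set` r] (dist e x y).
  by move=> [_]; rewrite -rE.
rewrite /weight (fsum_fibers mu (finite_seq r) (finite_trapezoid h1 h2 x) tr).
rewrite -[in RHS](size_iota h1 (h2 - h1)) mulr_natl -fsum_const ?iota_uniq //.
apply: eq_fsbigr => j /set_mem /=; rewrite rE => jh.
rewrite -[RHS](flow_descendants j); apply: eq_fsbigl.
apply/seteqP; split=> y /=.
  by move=> [/trapezoidP[i _ yi]]; rewrite (dist_descendant yi) => <-.
by move=> yj; split; [apply/trapezoidP; exists j | exact: dist_descendant].
Qed.

End FlowMeasure.

(** * Two boundary points and their axis *)

Section TwoEnds.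

Set Implicit Arguments.
Unset Strict Implicit.

Variables (T : choiceType) (e : rel T).
Hypothesis tree_e : is_tree e.
Variables w v : set (nat -> T).
Hypotheses (bw : boundary e w) (bv : boundary e v).

Lemma exists_parent_neq : v <> w -> exists x, parent v x <> parent w x.
Proof.
move=> vw; apply: contrapT => /forallNP nex; apply: vw.
have pE x : parent v x = parent w x by apply: contrapT; exact: nex.
have rE x : ray_to v x = ray_to w x.
  apply/funext => k; rewrite (ray_toE tree_e bv) (ray_toE tree_e bw).
  by apply: eq_iter.
apply/seteqP; split=> g gP.
  by rewrite -(ray_to_unique tree_e bv gP) rE; exact: (ray_toP tree_e bw _).1.
by rewrite -(ray_to_unique tree_e bw gP) -rE; exact: (ray_toP tree_e bv _).1.
Qed.

(** A vertex where the two parents differ is on the axis, with [w] on one side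
    and [v] on the other; the ray towards [v] then runs down the axis, since it
    can never turn back. *)
Lemma parent_axis x m : parent v x <> parent w x ->
  parent w (iter m.+1 (parent v) x) = iter m (parent v) x.
Proof.
move=> xP; pose z k := iter k (parent v) x.
have step k : parent v (z k) <> parent w (z k) -> parent w (z k.+1) = z k.
  by have [/esym|] := edge_parent tree_e bw (parent_edge tree_e bv (z k)).
suff zP k : parent v (z k) <> parent w (z k) by exact: step.
elim: k => [//|k IH]; rewrite step //.
exact: (parent_parent tree_e bv).
Qed.

(** When the edge above [a] is not on the axis, nor is any edge below [a], and
    both boundary points are reached by going up. *)
Lemma parent_off_axis a j y : parent v (parent w a) <> a ->
  descendants w j a y -> parent v y = parent w y.
Proof.
have step u : parent v (parent w u) <> u -> parent v u = parent w u.
  by have [|] := edge_parent tree_e bv (parent_edge tree_e bw u).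
move=> aP; elim: j y => [y|j IH y].
  by rewrite /descendants /= => ->; exact: step.
rewrite /descendants /= -iterS iterSr => yj; apply: step.
by rewrite IH //; exact: (parent_parent tree_e bw).
Qed.

End TwoEnds.

(** * The Jacobian of a map sending [v] to [w] *)

Section Inversion.

Set Implicit Arguments.
Unset Strict Implicit.

Variables (R : realType) (q : nat) (T : choiceType) (e : rel T).
Hypotheses (q_gt1 : (1 < q)%N) (hom : homogeneous_tree q e).
Variables w v : set (nat -> T).
Hypotheses (bw : boundary e w) (bv : boundary e v) (vw : v <> w).
Variable f : T -> T.
Hypothesis fvw : boundary_act f v = w.
Variable o : T.

Let tree_e : is_tree e. Proof. by case: hom. Qed.
Let q_gt0 : (0 < q)%N. Proof. exact: ltnW. Qed.
Let qR_gt0 : 0 < q%:R :> R. Proof. by rewrite ltr0n. Qed.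
Let qR_neq0 : q%:R != 0 :> R. Proof. exact: lt0r_neq0. Qed.

Local Notation mu := (flow R q e w o).
Local Notation Jf := (J mu f).

Let mu_gt0 x : 0 < mu x. Proof. exact: flow_gt0. Qed.
Let mu_neq0 x : mu x != 0. Proof. exact: lt0r_neq0. Qed.
Let J_gt0 x : 0 < Jf x. Proof. exact: J_flow_gt0. Qed.

(** The map [f] carries the ray from [x] to [v] onto a ray of [w] starting at
    [f x], and there is only one such ray. *)
Lemma parent_act x : f (parent v x) = parent w (f x).
Proof.
have [vr r0] := ray_toP tree_e bv x.
have wr : w (f \o ray_to v x) by rewrite -fvw; exists (ray_to v x).
by have := ray_to_unique tree_e bw wr; rewrite /parent /= r0 => ->.
Qed.

Lemma J_off_axis y : parent v y = parent w y -> Jf (parent w y) = Jf y.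
Proof.
move=> yE; rewrite /J -{1}yE parent_act !(flow_parent tree_e bw) //.
by rewrite invfM mulrACA divff // mul1r.
Qed.

Lemma J_axis z :
  parent w (parent v z) = z -> Jf (parent v z) = q%:R ^+ 2 * Jf z.
Proof.
move=> zE; rewrite /J parent_act -[in mu z]zE !(flow_parent tree_e bw) //.
by field; rewrite qR_neq0 mu_neq0.
Qed.

(** Doubling the height is the least ratio of an admissible trapezoid, and it is
    enough: the deepest axis vertex alone gives an average of [J f] exponential
    in [k], against which the number [k + 1] of generations is negligible. *)
Lemma A_p_lower_bound p : 1 < p -> exists x, forall k : nat,
  k.+1%:R * q%:R `^ (1 - p) <=
    average mu (trapezoid e w k.+1 (k.+1).*2 x) Jf *
    average mu (trapezoid e w k.+1 (k.+1).*2 x)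
      (fun y => Jf y `^ (- 1 / (p - 1))) `^ (p - 1).
Proof.
move=> p1.
have [x xP] := exists_parent_neq tree_e bw bv vw; exists x => k.
set E := trapezoid _ _ _ _ _.
have finE : finite_set E := finite_trapezoid hom w _ _ x.
(* [x] has [q > 1] children, only one of which can be on the axis *)
have [a [ax aP]] : exists a, parent w a = x /\ parent v (parent w a) <> a.
  apply: contrapT => /forallNP nex.
  have sub : (fset_set (children w x) `<=` [fset parent v x])%fset.
    apply/fsubsetP => y; rewrite in_fset_set; last exact: (finite_children hom).
    move=> /set_mem; rewrite /children inE /= => yx.
    apply/eqP; apply: contrapT => yv.
    by apply: (nex y); split=> //; rewrite yx; exact: nesym.
  have := fsubset_leq_card sub.
  by rewrite (card_children hom bw) cardfs1 leqNgt q_gt1.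
have WE : weight mu E = k.+1%:R * mu x.
  rewrite (flow_trapezoid R q_gt1 hom bw); congr (_%:R * _); lia.
have W0 : 0 < weight mu E by rewrite WE mulr_gt0 ?ltr0n.
pose m := k.*2.+1; pose z i := iter i (parent v) x.
have zw i : parent w (z i.+1) = z i by exact: (parent_axis tree_e bw bv _ xP).
have Jz i : Jf (z i) = q%:R ^+ i * q%:R ^+ i * Jf x.
  elim: i => [|i IH]; first by rewrite !mul1r.
  by rewrite /z /= J_axis ?IH; [rewrite !exprS; ring|exact: zw].
have muz i : q%:R ^+ i * mu (z i) = mu x.
  elim: i => [|i IH]; first by rewrite mul1r.
  by rewrite -IH -(zw i) (flow_parent tree_e bw) // exprSr mulrA.
have zE : E (z m).
  apply/(trapezoidP hom bw _ _ _ _); exists m; first by lia.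
  by rewrite /descendants; elim: m => // i IH; rewrite /mkset iterSr zw.
have avg_ge E' F : E' `<=` E -> (forall y, 0 <= F y) ->
    (weight mu E)^-1 * \sum_(y \in E') (F y * mu y) <= average mu E F.
  move=> E'E F0; apply: ler_wpM2l; first by rewrite invr_ge0 ltW.
  by apply: ler_fsum_subset => // y; rewrite mulr_ge0 // ltW.
have avg1 : q%:R ^+ m * Jf x / k.+1%:R <= average mu E Jf.
  have := avg_ge [set z m] Jf; rewrite fsbig_set1 => avgz.
  apply: le_trans (avgz _ _) => [|_ ->//|y]; last exact: ltW.
  rewrite WE Jz -(muz m) le_eqVlt; apply/orP; left; apply/eqP.
  by field; rewrite mu_neq0 expf_neq0 // nat1r pnatr_eq0.
have Ja j y : descendants w j a y -> Jf y = Jf x.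
  have Jp i u : descendants w i a u -> Jf u = Jf (parent w u).
    by move=> /(parent_off_axis tree_e bw bv aP) /J_off_axis ->.
  elim: j y => [|j IH] y ya; rewrite (Jp _ _ ya).
    by move: ya; rewrite /descendants /mkset /= => ->; rewrite ax.
  by apply: IH; move: ya; rewrite /descendants /mkset iterSr.
have mua : mu x = q%:R * mu a by rewrite -ax (flow_parent tree_e bw).
have avg2 : Jf x `^ (- 1 / (p - 1)) / q%:R <=
    average mu E (fun y => Jf y `^ (- 1 / (p - 1))).
  (* depths from [a] are one less than depths from [x] *)
  pose E' := trapezoid e w k k.*2.+1 a.
  have E'E : E' `<=` E.
    move=> y /(trapezoidP hom bw _ _ _ _)[j jk ya].
    apply/(trapezoidP hom bw _ _ _ _); exists j.+1; first by lia.
    by rewrite /descendants /= ya.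
  apply: le_trans (avg_ge _ _ E'E _) => [|y]; last exact: powR_ge0.
  rewrite (_ : \sum_(y \in E') _ = Jf x `^ (- 1 / (p - 1)) * weight mu E').
    rewrite WE (flow_trapezoid R q_gt1 hom bw) mua.
    have -> : (k.*2.+1 - k)%N = k.+1 by lia.
    rewrite le_eqVlt; apply/orP; left; apply/eqP.
    by field; rewrite mu_neq0 qR_neq0 nat1r pnatr_eq0.
  rewrite [RHS]mulr_fsumr; apply: eq_fsbigr => y /set_mem.
  by move=> /(trapezoidP hom bw k k.*2.+1 a y)[j _ /Ja ->].
have J0 := J_gt0 x; have p10 : 0 < p - 1 by rewrite subr_gt0.
have avg2p : (Jf x)^-1 * q%:R `^ (1 - p) <=
    average mu E (fun y => Jf y `^ (- 1 / (p - 1))) `^ (p - 1).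
  have -> : (Jf x)^-1 * q%:R `^ (1 - p) =
      (Jf x `^ (- 1 / (p - 1)) / q%:R) `^ (p - 1).
    rewrite powRM ?powR_ge0 ?invr_ge0 ?ltW //; congr (_ * _).
      by rewrite -powRrM divfK ?gt_eqF // powR_inv1 ?ltW.
    by rewrite -[q%:R^-1]powR_inv1 ?ltW // -powRrM mulN1r opprB.
  have L0 : 0 <= Jf x `^ (- 1 / (p - 1)) / q%:R.
    by rewrite divr_ge0 ?powR_ge0 ?ltW.
  have A0 := le_trans L0 avg2.
  by apply: ge0_ler_powR avg2; rewrite ?nnegrE // ltW.
apply: le_trans (ler_pM _ _ avg1 avg2p); last first.
- by rewrite mulr_ge0 ?invr_ge0 ?powR_ge0 ?ltW.
- apply: divr_ge0; last exact: ler0n.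
  by apply: mulr_ge0; [exact: exprn_ge0 | exact: ltW].
have -> : q%:R ^+ m * Jf x / k.+1%:R * ((Jf x)^-1 * q%:R `^ (1 - p)) =
    q%:R ^+ m / k.+1%:R * q%:R `^ (1 - p).
  by field; rewrite nat1r pnatr_eq0 (gt_eqF J0).
rewrite ler_wpM2r ?powR_ge0 // ler_pdivlMr ?ltr0n // -natrX -natrM ler_nat.
(* [(k + 1) ^ 2 <= q ^ (2 k) <= q ^ m] *)
have kq : (k < q ^ k)%N by exact: ltn_expl.
rewrite /m -addnn expnS expnD.
apply: leq_trans (leq_mul kq kq) _.
by rewrite leq_pmull.
Qed.

End Inversion.

(** * Failure of the Muckenhoupt condition *)

Theorem proposition4p1 (R : realType) (beta : R) (hbeta : 12%:R <= beta)
    (q : nat) (hq : (1 < q)%N)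
    (T : choiceType) (e : rel T) (hT : homogeneous_tree q e)
    (wstar : set (nat -> T)) (hwstar : boundary e wstar) (o : T)
    (f : T -> T) (hf : tree_isometry e f)
    (wminus : set (nat -> T)) (hwminus : boundary e wminus)
    (hne : wminus <> wstar)
    (hf1 : boundary_act f wstar = wminus)
    (hf2 : boundary_act f wminus = wstar) :
  ~ A_infty (flow R q e wstar o) (admissible_family beta e wstar)
      (J (flow R q e wstar o) f).
Proof.
move=> [p p1 [_ sup_lty]].
have [x lb] := A_p_lower_bound hq hT hwstar hwminus hne hf2 o p1.
set S := ereal_sup _ in sup_lty.
have lbS k : ((k.+1%:R * q%:R `^ (1 - p))%:E <= S)%E.
  apply: le_trans; last first.
    apply: ereal_sup_ubound; exists (trapezoid e wstar k.+1 (k.+1).*2 x) => //.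
    right; exists x, k.+1, (k.+1).*2.
    have -> : (k.+1).*2%:R / k.+1%:R = 2 :> R.
      by rewrite -muln2 natrM mulrAC divff ?mul1r // pnatr_eq0.
    split=> //; first by lia.
    by apply: le_trans hbeta; rewrite ler_nat.
  by rewrite lee_fin; exact: lb.
have C0 : 0 < q%:R `^ (1 - p) :> R by rewrite powR_gt0 // ltr0n ltnW.
(* some [k] with [k + 1 > M / q `^ (1 - p)] contradicts a finite supremum [M] *)
case: S sup_lty lbS => [M _| |_ /(_ 0%N)] // lbM.
have := lbM (Num.truncn (M / q%:R `^ (1 - p))).
rewrite lee_fin -ler_pdivlMr // leNgt => /negP; apply.
exact: truncnS_gt.
Qed.
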